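(* Let $\beta>0$ and let $x^*\neq0$ be a strong $\beta$-Lagrangian stationary point, with Lagrangian multiplier $y^*\in\mathbb{R}^m$, of the problem $\min_{x\in\mathbb{R}^n} f(x)$ subject to $h(x)=0$, $x\in\mathbb{S}$. Suppose that for every $T\in\mathcal{J}_s(x^* )$, $\mathrm{rank}(\nabla_Th(x^* ))=m$ and $d^\top(\nabla^2_{xx}L(x^*,y^* ))_{T,T}\,d>0$ for every nonzero $d\in\mathbb{R}^s$ with $\nabla_Th(x^* )d=0$; and suppose that $\nabla^2f$ and $\nabla^2h_i$ $(i=1,\dots,m)$ are Lipschitz continuous near $x^*$. Then there exist constants $\tilde\delta^*\in(0,\delta^*]$ and $M^*\in(0,+\infty)$ such that for every $z=(x;y)\in\mathcal{N}_{\mathbb{S}}(z^*;\tilde\delta^* )$ with $z^*=(x^*;y^* )$, the matrix $G(x,y;T)$ is nonsingular and $$\|G^{-1}(x,y;T)\|\le M^*\qquad\text{for all } T\in\mathbb{T}(x,y;\beta).$$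
   Context: Let $n,m,s$ be positive integers with $0<s<n$; $f:\mathbb{R}^n\to\mathbb{R}$ and $h=(h_1,\dots,h_m)^\top:\mathbb{R}^n\to\mathbb{R}^m$ are twice continuously differentiable. $\|x\|_0$ is the number of nonzero components of $x$, $\mathbb{S}=\{x\in\mathbb{R}^n:\|x\|_0\le s\}$, $\mathrm{supp}(x)=\{i:x_i\neq0\}$, $\mathcal{J}_s=\{J\subseteq\{1,\dots,n\}:|J|=s\}$, $\mathcal{J}_s(x)=\{J\in\mathcal{J}_s:\mathrm{supp}(x)\subseteq J\}$; $T^c=\{1,\dots,n\}\setminus T$. $A_{T,T}$ is the submatrix with rows and columns indexed by $T$. $\nabla h(x)\in\mathbb{R}^{m\times n}$ is the Jacobian of $h$ and $\nabla_Th(x)$ its submatrix of columns indexed by $T$. $\|\cdot\|$ is the Euclidean norm of vectors and the spectral norm of matrices. Lagrangian: $L(x,y)=f(x)-\langle y,h(x)\rangle$; $\nabla_xL$ is its gradient in $x$, $\nabla^2_{xx}L(x,y)=\nabla^2f(x)-\sum_iy_i\nabla^2h_i(x)$, and $\nabla^2L(x,y)$ is its full Hessian in $(x,y)$. $\Pi_{\mathbb{S}}(z)=\arg\min_{w\in\mathbb{S}}\|z-w\|^2$ (in general a set). $x^*$ is a strong $\beta$-Lagrangian stationary point with Lagrangian multiplier $y^*$ if $x^*=\Pi_{\mathbb{S}}(x^*-\beta\nabla_xL(x^*,y^* ))$ (meaning the projection set is the singleton $\{x^*\}$) and $h(x^* )=0$. For $x\in\mathbb{S}$, $y\in\mathbb{R}^m$,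 put $u=x-\beta\nabla_xL(x,y)$ and $\mathbb{T}(x,y;\beta)=\{T\in\mathcal{J}_s: |u_i|\ge|u_j|\ \forall i\in T,\ \forall j\in T^c\}$. For $T\in\mathcal{J}_s$, $$G(x,y;T)=\begin{bmatrix}(\nabla^2_{xx}L(x,y))_{T,T}&-(\nabla_Th(x))^\top\\-\nabla_Th(x)&0\end{bmatrix}\in\mathbb{R}^{(s+m)\times(s+m)}.$$ Constants: by the local Lipschitz assumption there are positive constants $\delta_0^*,L_1,L_2$, fixed once and for all, such that for all $z=(x;y),\hat z=(\hat x;\hat y)$ in the ball of radius $\delta_0^*$ around $z^*=(x^*;y^* )$, $\|\nabla_xL(x,y)-\nabla_xL(\hat x,\hat y)\|\le L_1\|z-\hat z\|$ and $\|\nabla^2L(x,y)-\nabla^2L(\hat x,\hat y)\|\le L_2\|z-\hat z\|$. With $\Gamma^*=\mathrm{supp}(x^* )$ and $q^*=\nabla_xL(x^*,y^* )$ let $$\delta_1^*=\frac{\min_{i\in\Gamma^*}|x_i^*|-\beta\max_{i\in(\Gamma^* )^c}|q_i^*|}{\sqrt2(1+\beta L_1)}\ (>0),\qquad \delta^*=\min\{\delta_0^*,\delta_1^*\}.$$ For $\delta>0$, $\mathcal{N}_{\mathbb{S}}(z^*;\delta)=\{z=(x;y)\in\mathbb{R}^{n+m}:x\in\mathbb{S},\ \|z-z^*\|<\delta\}$. *)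

(* Defs.v *)
(* MathComp-Analysis, over an arbitrary [R : realType]. *)
From HB Require Import structures.
From mathcomp Require Import all_boot all_order all_algebra.
From mathcomp Require Import all_classical all_reals all_analysis.

Set Implicit Arguments.
Unset Strict Implicit.
Unset Printing Implicit Defensive.

Import Order.TTheory GRing.Theory Num.Theory.
Import numFieldNormedType.Exports.

Local Open Scope classical_set_scope.
Local Open Scope ring_scope.

Section Norms.
Context {R : realType}.

(* Only used on row and column vectors, where it is the Euclidean norm.
   The norm `|_| that the library puts on matrices is the max norm. *)
Definition norm2 p q (v : 'M[R]_(p, q)) : R :=
  Num.sqrt (\sum_i \sum_j v i j ^+ 2).

(* Operator norm induced by the Euclidean norms; the set is nonempty and
   bounded, so that [sup] is a genuine supremum. *)
Definition spnorm p q (A : 'M[R]_(p, q)) : R :=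
  sup [set norm2 (A *m v) | v in [set v : 'cV[R]_q | norm2 v <= 1]].

End Norms.

Section Calculus.
Context {R : realType} {n : nat}.

Definition grad (f : 'rV[R]_n -> R) (x : 'rV[R]_n) : 'rV[R]_n :=
  \row_i 'D_(delta_mx 0 i) f x.

Definition hess (f : 'rV[R]_n -> R) (x : 'rV[R]_n) : 'M[R]_n := 'J (grad f) x.

(* The library's ['J h x] acts on row vectors from the right, i.e. its entry
   (j, i) is the j-th partial derivative of h_i; hence the transpose. *)
Definition Jac m (h : 'rV[R]_n -> 'rV[R]_m) (x : 'rV[R]_n) : 'M[R]_(m, n) :=
  ('J h x)^T.

Definition twice_continuously_differentiable (f : 'rV[R]_n -> R) : Prop :=
  [/\ forall x, differentiable f x,
      forall x, differentiable (grad f) x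
    & continuous (hess f)].

Definition lipschitz_near p q (F : 'rV[R]_n -> 'M[R]_(p, q)) (x0 : 'rV[R]_n)
    : Prop :=
  exists r K : R, [/\ 0 < r, 0 < K &
    forall x x', norm2 (x - x0) < r -> norm2 (x' - x0) < r ->
      spnorm (F x - F x') <= K * norm2 (x - x')].

End Calculus.

Section Sparse.
Context {R : realType} {n : nat}.

Definition supp (x : 'rV[R]_n) : {set 'I_n} := [set i | x 0 i != 0]%SET.

Definition norm0 (x : 'rV[R]_n) : nat := #|supp x|.

Definition sparse (s : nat) : set 'rV[R]_n := [set x | (norm0 x <= s)%N].

Definition proj (S : set 'rV[R]_n) (z : 'rV[R]_n) : set 'rV[R]_n :=
  [set w | S w /\ forall v, S v -> norm2 (z - w) ^+ 2 <= norm2 (z - v) ^+ 2].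

Definition Js (s : nat) : {set {set 'I_n}} := [set J : {set 'I_n} | #|J| == s]%SET.

Definition Js_at (s : nat) (x : 'rV[R]_n) : {set {set 'I_n}} :=
  [set J in Js s | supp x \subset J]%SET.

(* Rows and columns are listed in the increasing order of the indices in T;
   for T in [Js s] the dimension #|T| is s. *)
Definition submxTT (T : {set 'I_n}) (A : 'M[R]_n) : 'M[R]_#|T| :=
  mxsub (@enum_val _ (mem T)) (@enum_val _ (mem T)) A.

Definition subcols m (T : {set 'I_n}) (A : 'M[R]_(m, n)) : 'M[R]_(m, #|T|) :=
  colsub (@enum_val _ (mem T)) A.

End Sparse.

Section Lagrangian.
Context {R : realType} {n m : nat}.
Variables (f : 'rV[R]_n -> R) (h : 'rV[R]_n -> 'rV[R]_m).

Definition lagr (x : 'rV[R]_n) (y : 'rV[R]_m) : R :=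
  f x - \sum_i y 0 i * h x 0 i.

Definition gradx_lagr (x : 'rV[R]_n) (y : 'rV[R]_m) : 'rV[R]_n :=
  grad (lagr^~ y) x.

Definition hessxx_lagr (x : 'rV[R]_n) (y : 'rV[R]_m) : 'M[R]_n :=
  hess (lagr^~ y) x.

Definition hess_lagr (x : 'rV[R]_n) (y : 'rV[R]_m) : 'M[R]_(n + m) :=
  hess (fun z : 'rV[R]_(n + m) => lagr (lsubmx z) (rsubmx z)) (row_mx x y).

Definition strong_lagr_stationary (s : nat) (beta : R)
    (x : 'rV[R]_n) (y : 'rV[R]_m) : Prop :=
  proj (sparse s) (x - beta *: gradx_lagr x y) = [set x] /\ h x = 0.

Definition TT (s : nat) (beta : R) (x : 'rV[R]_n) (y : 'rV[R]_m)
    : {set {set 'I_n}} :=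
  let u := x - beta *: gradx_lagr x y in
  [set T in Js s |
     [forall i in T, forall j in ~: T, `|u 0 j| <= `|u 0 i|]]%SET.

Definition G (x : 'rV[R]_n) (y : 'rV[R]_m) (T : {set 'I_n})
    : 'M[R]_(#|T| + m) :=
  block_mx (submxTT T (hessxx_lagr x y)) (- (subcols T (Jac h x))^T)
           (- subcols T (Jac h x))       0.

(* The two index sets are finite, and nonempty when x <> 0 has at most s < n
   nonzero entries: [inf] and [sup] are then a minimum and a maximum. *)
Definition delta1 (beta L1 : R) (x : 'rV[R]_n) (y : 'rV[R]_m) : R :=
  let q := gradx_lagr x y in
  (inf [set `|x 0 i| | i in [set i | i \in supp x]]
   - beta * sup [set `|q 0 i| | i in [set i | i \in ~: supp x]])
  / (Num.sqrt 2 * (1 + beta * L1)).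

Definition nbhd_sparse (s : nat) (xs : 'rV[R]_n) (ys : 'rV[R]_m) (delta : R)
    : set 'rV[R]_(n + m) :=
  [set z | sparse s (lsubmx z) /\ norm2 (z - row_mx xs ys) < delta].

End Lagrangian.

(* Main.v *)
(* At zs = (xs, ys) the matrix G(zs; T) is a KKT matrix, invertible for every T
   in J_s(xs) by the rank condition and the second-order condition.  It depends
   continuously on z and J_s(xs) is finite, so invertibility and a bound on the
   inverse hold uniformly near zs.  It remains to see that T(x, y; beta) is
   contained in J_s(xs) for z near zs.  That xs is the only projection of
   us = xs - beta q forces us_i = xs_i on the support (restore this entry) and
   beta |q_j| < |xs_i| for i in and j off the support (exchange the two entries).
   This gap makes delta1 positive, and it persists for z within delta1 / 2 of zs,
   so that the s largest entries of u cover the support. *)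
Require Import Defs.
From HB Require Import structures.
From mathcomp Require Import all_boot all_order all_algebra.
From mathcomp Require Import all_classical all_reals all_analysis.
From mathcomp Require Import ring lra.
Import Order.TTheory GRing.Theory Num.Theory.
Import numFieldNormedType.Exports.
Local Open Scope classical_set_scope.
Local Open Scope ring_scope.

(** * Max norm against Euclidean norm, and stability of invertibility *)

Section MatrixNorms.
Context {R : realType}.

Lemma le_norm_mx_entry {p q} (A : 'M[R]_(p, q)) i j : `|A i j| <= `|A|.
Proof.
by rewrite [leRHS]/Num.norm /= mx_normrE; exact: (le_bigmax _ _ (i, j)).
Qed.

Lemma norm_mx_le {p q} (A : 'M[R]_(p, q)) (c : R) :
  0 <= c -> (forall i j, `|A i j| <= c) -> `|A| <= c.
Proof.
by move=> c0 Ac; rewrite [leLHS]/Num.norm /= mx_normrE; apply: bigmax_le.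
Qed.

Lemma norm_mx_lt {p q} (A : 'M[R]_(p, q)) (c : R) :
  0 < c -> (forall i j, `|A i j| < c) -> `|A| < c.
Proof.
by move=> c0 Ac; rewrite [ltLHS]/Num.norm /= mx_normrE; apply: bigmax_lt.
Qed.

(** The max norm is not submultiplicative: an entry of the product is a sum of [q] terms, which
    costs the factor [q]. *)
Lemma norm_mulmx {p q r} (A : 'M[R]_(p, q)) (B : 'M[R]_(q, r)) :
  `|A *m B| <= q%:R * `|A| * `|B|.
Proof.
apply: norm_mx_le => [|i j]; first by rewrite !mulr_ge0.
rewrite mxE (le_trans (ler_norm_sum _ _ _))//.
rewrite -mulrA mulr_natl -[X in _ <= _ *+ X]card_ord -sumr_const.
apply: ler_sum => k _; rewrite normrM.
by apply: ler_pM => //; exact: le_norm_mx_entry.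
Qed.

Lemma norm2_ge0 {p q} (A : 'M[R]_(p, q)) : 0 <= norm2 A.
Proof. exact: sqrtr_ge0. Qed.

Lemma norm_entry_le_norm2 {p q} (A : 'M[R]_(p, q)) i j : `|A i j| <= norm2 A.
Proof.
rewrite -sqrtr_sqr ler_wsqrtr// (bigD1 i)//= (bigD1 j)//= -addrA lerDl.
by rewrite addr_ge0// !sumr_ge0// => k _; rewrite ?sumr_ge0// => *; exact: sqr_ge0.
Qed.

Lemma norm_le_norm2 {p q} (A : 'M[R]_(p, q)) : `|A| <= norm2 A.
Proof.
by apply: norm_mx_le => [|i j]; [exact: norm2_ge0|exact: norm_entry_le_norm2].
Qed.

Lemma norm2_le_norm {p q} (A : 'M[R]_(p, q)) :
  norm2 A <= Num.sqrt (p * q)%:R * `|A|.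
Proof.
rewrite -[X in _ * X]normr_id -sqrtr_sqr -sqrtrM// ler_wsqrtr//.
rewrite natrM -mulrA mulr_natl -[X in _ <= _ *+ X]card_ord -sumr_const.
apply: ler_sum => i _.
rewrite mulr_natl -[X in _ <= _ *+ X]card_ord -sumr_const.
apply: ler_sum => j _.
by rewrite -real_normK ?num_real// lerXn2r ?nnegrE// le_norm_mx_entry.
Qed.

Lemma norm2_0 {p q} : norm2 (0 : 'M[R]_(p, q)) = 0.
Proof.
rewrite /norm2 big1 ?sqrtr0// => i _; rewrite big1// => j _.
by rewrite mxE expr0n.
Qed.

Lemma sqr_norm2_row {n} (v : 'rV[R]_n) : norm2 v ^+ 2 = \sum_k v 0 k ^+ 2.
Proof.
rewrite sqr_sqrtr ?big_ord1// sumr_ge0// => k _.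
by rewrite sqr_ge0.
Qed.

Lemma spnorm_le {p q} (A : 'M[R]_(p, q)) (c : R) :
  (forall v : 'cV[R]_q, norm2 v <= 1 -> norm2 (A *m v) <= c) -> spnorm A <= c.
Proof.
move=> Ac; apply: ge_sup => [|_ [v /= v1 <-]]; last exact: Ac.
(* A bound on [sup] needs a nonempty set; the zero vector provides a member. *)
by exists (norm2 (A *m (0 : 'cV_q))), 0 => //=; rewrite norm2_0.
Qed.

(** Transposition turns injectivity on columns into the row-vector criterion for a free matrix. *)
Lemma inj_unitmx {F : fieldType} {k} (A : 'M[F]_k) :
  (forall v : 'cV[F]_k, A *m v = 0 -> v = 0) -> A \in unitmx.
Proof.
move=> Ainj; rewrite -unitmx_tr -row_free_unit; apply/inj_row_free => v vA.
apply: trmx_inj; rewrite trmx0; apply: Ainj; apply: trmx_inj.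
by rewrite trmx_mul trmxK vA trmx0.
Qed.

(* Near [A], [|v| <= 2 F |B v|] with [F] controlling [invmx A]: this gives both
   injectivity of [B] and the bound on its inverse. *)
Lemma unitmx_perturb {k} (A : 'M[R]_k) : A \in unitmx ->
  exists c M : R, [/\ 0 < c, 0 < M & forall B : 'M[R]_k, `|A - B| < c ->
    B \in unitmx /\ spnorm (invmx B) <= M].
Proof.
(* The [+ 1] here and in [k%:R + 1] below keeps both factors positive even for [k = 0]. The radius
   [c] is chosen so that [F * (k%:R * c)] is at most one half. *)
move=> Au; pose F : R := k%:R * `|invmx A| + 1.
have F0 : 0 < F by rewrite ltr_wpDl// mulr_ge0.
pose c : R := (2 * F * (k%:R + 1))^-1.
have k0 : 0 < k%:R + 1 :> R by rewrite ltr_wpDl.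
have c0 : 0 < c by rewrite invr_gt0 !mulr_gt0.
have Fkc : F * (k%:R * c) <= 2^-1.
  have -> : F * (k%:R * c) = 2^-1 * (k%:R / (k%:R + 1)).
    by rewrite /c; field; rewrite !gt_eqF.
  by rewrite ler_piMr// ler_pdivrMr// mul1r lerDl.
(* The square root converts the max norm of a column into its Euclidean norm; [2 * F] is the
   constant of [lower]. *)
pose N : R := Num.sqrt (k * 1)%:R * (2 * F).
exists c, (N + 1); split=> //.
  by rewrite ltr_wpDl// !mulr_ge0// ?sqrtr_ge0// ltW.
move=> B AB.
have lower (v : 'cV[R]_k) : `|v| <= 2 * F * `|B *m v|.
  have h1 : `|v| <= F * `|A *m v|.
    rewrite -{1}[v](mulKmx Au) (le_trans (norm_mulmx _ _))// ler_wpM2r//.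
    by rewrite lerDl.
  have h2 : `|A *m v| <= `|B *m v| + k%:R * c * `|v|.
    rewrite -[A](subrK B) mulmxDl addrC (le_trans (ler_normD _ _))// lerD2l.
    rewrite (le_trans (norm_mulmx _ _))// ler_wpM2r// ler_wpM2l//.
    exact: ltW.
  (* The choice of [c] makes the error term at most half of [|v|], to be absorbed on the left. *)
  have h3 : F * `|A *m v| <= F * `|B *m v| + 2^-1 * `|v|.
    rewrite (le_trans (ler_wpM2l (ltW F0) h2))// mulrDr lerD2l mulrA.
    by rewrite ler_wpM2r.
  lra.
have Bu : B \in unitmx.
  apply: inj_unitmx => v Bv; apply/eqP; rewrite -normr_le0.
  by rewrite (le_trans (lower v))// Bv normr0 mulr0.
split=> //; apply: spnorm_le => v v1.
apply: le_trans (norm2_le_norm _) _; rewrite -[leLHS]addr0 lerD// /N.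
rewrite ler_wpM2l ?sqrtr_ge0//; apply: le_trans (lower _) _.
rewrite mulKVmx// ler_piMr ?mulr_ge0 ?(ltW F0)//.
exact: le_trans (norm_le_norm2 _) v1.
Qed.

End MatrixNorms.

(** A kernel vector [(d; w)] satisfies [A d = 0] and [H d = A^T w], so [d^T H d = (A d)^T w = 0] and
    [d = 0]. Then [w^T A = 0], and full row rank gives [w = 0]. Over a field without order,
    definiteness on the kernel reads as nonvanishing. *)
Lemma bordered_unitmx {F : fieldType} {p m} (H : 'M[F]_p) (A : 'M[F]_(m, p)) :
  \rank A = m ->
  (forall d : 'cV[F]_p, d != 0 -> A *m d = 0 -> (d^T *m H *m d) 0 0 != 0) ->
  block_mx H (- A^T) (- A) 0 \in unitmx.
Proof.
move=> rA pos; apply: inj_unitmx => v.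
rewrite -[v]vsubmxK; set d := usubmx v; set w := dsubmx v.
rewrite mul_block_col mul0mx addr0 !mulNmx -[0]vsubmxK => /eq_col_mx[].
rewrite !linear0 => Hd /eqP; rewrite oppr_eq0 => /eqP Ad.
have HdE : H *m d = A^T *m w by apply/eqP; rewrite -subr_eq0 Hd.
have d0 : d = 0.
  apply/eqP/negPn/negP => dn0; have := pos _ dn0 Ad.
  by rewrite -mulmxA HdE mulmxA -trmx_mul Ad trmx0 mul0mx mxE eqxx.
have Aw : w^T *m A = 0.
  by apply: trmx_inj; rewrite trmx_mul trmxK -HdE d0 mulmx0 trmx0.
have w0 : w^T = 0.
  by apply: (row_free_inj (A := A)); rewrite ?mul0mx// /row_free rA.
by rewrite d0 -[w]trmxK w0 trmx0 col_mx0.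
Qed.

(** * Projection onto sparse vectors, and supports *)

Section SparseProjection.
Context {R : realType} {n : nat}.
Implicit Types u x : 'rV[R]_n.

(* Compare [x] with the sparse vector obtained by restoring [u 0 i]. *)
Lemma proj_supp {s u x} i :
  Defs.proj (sparse s) u x -> i \in supp x -> u 0 i = x 0 i.
Proof.
move=> [xs xmin] ix; pose w : 'rV[R]_n := \row_k if k == i then u 0 i else x 0 k.
have ws : sparse s w.
  apply: leq_trans xs; apply: subset_leq_card; apply/fintype.subsetP => k.
  by rewrite !inE mxE; have [->|//] := eqVneq k i; move: ix; rewrite inE.
have := xmin _ ws; rewrite !sqr_norm2_row (bigD1 i)//= [leRHS](bigD1 i)//=.
rewrite (eq_bigr (fun k => (u - w) 0 k ^+ 2)); last first.
  by move=> k /negPf ki; rewrite !mxE ki.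
rewrite lerD2r !mxE eqxx subrr expr0n/= => h.
by apply/eqP; rewrite -subr_eq0 -sqrf_eq0 eq_le h sqr_ge0.
Qed.

(* Otherwise exchanging the entries [i] and [j] would give a second
   minimizer. *)
Lemma proj_singleton_gap {s u x} i j : Defs.proj (sparse s) u = [set x] ->
  i \in supp x -> j \notin supp x -> `|u 0 j| < `|x 0 i|.
Proof.
move=> ux ix jx; have px : Defs.proj (sparse s) u x by rewrite ux.
have ui := proj_supp _ px ix; have [xs xmin] := px.
have xi0 : x 0 i != 0 by move: ix; rewrite inE.
have /eqP xj0 : x 0 j == 0 by move: jx; rewrite inE negbK.
have ji : j != i by apply: contraNneq jx => ->.
rewrite ltNge; apply/negP => xu.
(* Since [u 0 i = x 0 i], clearing entry [i] adds [x 0 i ^+ 2] to the squared distance, and filling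
   entry [j] removes [u 0 j ^+ 2], which is at least as large by [xu]. *)
pose w : 'rV[R]_n :=
  \row_k if k == i then 0 else if k == j then u 0 j else x 0 k.
suff : Defs.proj (sparse s) u w.
  rewrite ux/= => wx; move: xi0; rewrite -wx mxE eqxx.
  by rewrite eqxx.
have ws : sparse s w.
  apply: leq_trans xs; rewrite /norm0 [leqRHS](cardsD1 i) ix.
  apply: leq_trans (leq_trans (leq_card_setU [set j]%SET (supp x :\ i)) _);
    last by rewrite cards1.
  apply: subset_leq_card; apply/fintype.subsetP => k; rewrite !inE mxE.
  by have [->|ki] := eqVneq k i; rewrite ?eqxx//; have [->|] := eqVneq k j.
split=> // v /xmin; apply: le_trans; rewrite !sqr_norm2_row.
rewrite (bigD1 i)//= [leRHS](bigD1 i)//= (bigD1 j)//= [X in _ <= _ + X](bigD1 j)//=.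
rewrite (eq_bigr (fun k => (u - x) 0 k ^+ 2)); last first.
  by move=> k /andP[/negPf ki /negPf kj]; rewrite !mxE ki kj.
rewrite !mxE eqxx (negPf ji) eqxx ui xj0 !subrr !subr0 expr0n/= addrA addr0.
rewrite addrA add0r lerD2r.
by rewrite -(real_normK (num_real (x 0 i))) -(real_normK (num_real (u 0 j)))
  lerXn2r ?nnegrE.
Qed.

(** If [T] missed some [i] of the support, then, having at least as many elements as the support, it
    would contain some [j] off it; the two comparisons of [u] at [i] and [j] contradict each
    other. *)
Lemma top_set_supp {s u x} (T : {set 'I_n}) : sparse s x -> T \in Js s ->
  (forall i j, i \in T -> j \notin T -> `|u 0 j| <= `|u 0 i|) ->
  (forall i j, i \in supp x -> j \notin supp x -> `|u 0 j| < `|u 0 i|) ->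
  T \in Js_at s x.
Proof.
move=> xs Ts uT ux; rewrite inE Ts/=; apply/fintype.subsetP => i ix.
apply/negPn/negP => iT.
have /fintype.subsetPn[j jT jx] : ~~ (T \subset supp x).
  apply/negP => Tx; have : (#|T| < #|supp x|)%N.
    by apply: proper_card; rewrite properE Tx; apply/fintype.subsetPn; exists i.
  by rewrite ltnNge; move: Ts xs; rewrite inE => /eqP -> ->.
by have := uT _ _ jT iT; rewrite leNgt ux.
Qed.

End SparseProjection.

(** * The radius [delta1] as a measure of the gap *)

Section Delta1.
Context {R : realType} {n m s : nat}.
Variables (f : 'rV[R]_n -> R) (h : 'rV[R]_n -> 'rV[R]_m).
Variables (beta L1 : R) (xs : 'rV[R]_n) (ys : 'rV[R]_m).
Hypotheses (beta_gt0 : 0 < beta) (L1_gt0 : 0 < L1).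

Let q := gradx_lagr f h xs ys.
Let C := 1 + beta * L1.

Let C_gt0 : 0 < C.
Proof. by rewrite addr_gt0// mulr_gt0. Qed.

(** Clearing the denominator of [delta1] leaves an infimum minus [beta] times a supremum, each
    compared with one of its members. *)
Lemma delta1_le i j : i \in supp xs -> j \notin supp xs ->
  beta * `|q 0 j| + Num.sqrt 2 * C * delta1 f h beta L1 xs ys <= `|xs 0 i|.
Proof.
move=> ix jx; rewrite /delta1 -/q -/C [_ * C * _]mulrC mulfVK; last first.
  by rewrite mulf_neq0 ?gt_eqF// sqrtr_gt0.
set I := inf _; set S := sup _.
have I_le : I <= `|xs 0 i|.
  by apply: ge_inf; [exists 0 => _ [k _ <-]|exists i].
have le_S : `|q 0 j| <= S.
  apply: ub_le_sup; last by exists j => //=; rewrite inE.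
  by exists `|q| => _ [k _ <-]; exact: le_norm_mx_entry.
have := ler_wpM2l (ltW beta_gt0) le_S; lra.
Qed.

(** Both index sets are finite and nonempty, so it suffices to apply the gap of the projection to a
    smallest entry of [xs] on the support and a largest entry of [q] off it. *)
Lemma delta1_gt0 : (s < n)%N -> xs != 0 ->
  Defs.proj (sparse s) (xs - beta *: q) = [set xs] ->
  0 < delta1 f h beta L1 xs ys.
Proof.
move=> sn xs0 pxs; have [xss _] : Defs.proj (sparse s) (xs - beta *: q) xs.
  by rewrite pxs.
rewrite /delta1 -/q -/C divr_gt0// ?mulr_gt0// ?sqrtr_gt0// subr_gt0.
have [i0 i0x] : exists i, i \in supp xs.
  move: xs0; apply: contra_neqP => nx; apply/rowP => i; rewrite mxE.
  apply/eqP/negPn/negP => xi; apply: nx; exists i.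
  by rewrite inE.
(* At most [s < n] entries of [xs] are nonzero, so the support is not everything. *)
have [j0 j0x] : exists j, j \notin supp xs.
  apply/existsP; rewrite -negb_forall; apply/negP => /forallP xall.
  move: xss; rewrite /sparse/= /norm0 leqNgt.
  by rewrite (eq_card (B := 'I_n)) ?card_ord ?sn// => i; rewrite xall.
have [i ix imin] := arg_minP (fun i => `|xs 0 i|) i0x.
have [j jx jmax] := @arg_maxP _ _ _ j0 (fun j => j \notin supp xs)
  (fun j => `|q 0 j|) j0x.
apply: (@le_lt_trans _ _ (beta * `|q 0 j|)).
  rewrite ler_pM2l//; apply: ge_sup => [|_ [k /= kx <-]].
    by exists `|q 0 j|, j => //=; rewrite inE.
  by apply: jmax; rewrite inE in kx.
apply: (@lt_le_trans _ _ `|xs 0 i|).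
  have := proj_singleton_gap _ _ pxs ix jx.
  rewrite !mxE; move: jx; rewrite inE negbK => /eqP ->.
  by rewrite sub0r normrN normrM gtr0_norm.
apply: lb_le_inf => [|_ [k /= kx <-]]; last exact: imin.
by exists `|xs 0 i|, i.
Qed.

End Delta1.

(** * Derivatives of the Lagrangian and their continuity *)

Section LagrangianDerivatives.
Context {R : realType} {n m : nat}.

(** There are finitely many entries, so their neighborhoods can be intersected. *)
Lemma cvg_mx {V : topologicalType} {p q} (F : set_system V) {FF : Filter F}
    (M : V -> 'M[R]_(p, q)) (A : 'M[R]_(p, q)) :
  (forall i j, M v i j @[v --> F] --> A i j) -> M @ F --> A.
Proof.
move=> MA; apply/cvgrPdist_lt => e e0.
have : \forall v \near F, forall ij : 'I_p * 'I_q,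
    `|A ij.1 ij.2 - M v ij.1 ij.2| < e.
  by apply: filter_forall => -[i j]; move/cvgrPdist_lt : (MA i j); exact.
apply: filterS => v Mv; apply: norm_mx_lt => // i j.
by rewrite !mxE; exact: (Mv (i, j)).
Qed.

Lemma cvg_sum_ord {T} {F : set_system T} {FF : Filter F} {k}
    (u : 'I_k -> T -> R) (l : 'I_k -> R) :
  (forall i, u i x @[x --> F] --> l i) ->
  (\sum_i u i x) @[x --> F] --> \sum_i l i.
Proof.
move=> ul; rewrite -fct_sumE; elim/big_ind2: _ => // [|g a g' a' ga ga'].
  exact: cvg_cst.
exact: cvgD.
Qed.

Lemma derivative_comb (f : 'rV[R]_n -> R) (g : 'I_m -> 'rV[R]_n -> R)
    (y : 'rV[R]_m) x v :
  differentiable f x -> (forall k, differentiable (g k) x) ->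
  'D_v (f - \sum_k y 0 k *: g k) x =
    'D_v f x - \sum_k y 0 k * 'D_v (g k) x.
Proof.
move=> df dg; have dyg k : derivable (y 0 k *: g k) x v.
  by apply: derivableZ; exact: diff_derivable.
rewrite deriveB; [|exact: diff_derivable|exact: derivable_sum].
rewrite derive_sum//; congr (_ - _); apply: eq_bigr => k _.
by rewrite deriveZ//; exact: diff_derivable.
Qed.

Lemma hessE (f : 'rV[R]_n -> R) x i j : differentiable (grad f) x ->
  hess f x i j = 'D_(delta_mx 0 i) (fun x => grad f x 0 j) x.
Proof.
move=> df; have := deriveEjacobian (delta_mx 0 i) df.
rewrite derive_mx; last exact: diff_derivable.
by move=> /(congr1 (fun A : 'rV_n => A 0 j)); rewrite -rowE !mxE.
Qed.

Lemma differentiable_grad_entry (f : 'rV[R]_n -> R) x j :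
  differentiable (grad f) x -> differentiable (fun x => grad f x 0 j) x.
Proof.
move=> df.
apply: (@differentiable_comp _ _ _ _ (grad f) (fun v : 'rV[R]_n => v 0 j)) => //.
exact: differentiable_coord.
Qed.

Lemma grad_comb (f : 'rV[R]_n -> R) (g : 'I_m -> 'rV[R]_n -> R)
    (y : 'rV[R]_m) :
  (forall x, differentiable f x) -> (forall k x, differentiable (g k) x) ->
  grad (f - \sum_k y 0 k *: g k) = grad f - \sum_k y 0 k *: grad (g k).
Proof.
move=> df dg; apply/funext => x; apply/rowP => i.
rewrite mxE derivative_comb// [in RHS]fctE [in RHS]fctE fct_sumE !mxE summxE.
congr (_ - _).
by apply: eq_bigr => k _; rewrite !mxE.
Qed.

Lemma hess_comb (f : 'rV[R]_n -> R) (g : 'I_m -> 'rV[R]_n -> R)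
    (y : 'rV[R]_m) x i j :
  (forall x, differentiable f x) -> (forall k x, differentiable (g k) x) ->
  (forall x, differentiable (grad f) x) ->
  (forall k x, differentiable (grad (g k)) x) ->
  hess (f - \sum_k y 0 k *: g k) x i j =
    hess f x i j - \sum_k y 0 k * hess (g k) x i j.
Proof.
move=> df dg df' dg'.
have dF : differentiable (grad (f - \sum_k y 0 k *: g k)) x.
  rewrite (grad_comb _ _ _ df dg); apply: differentiableB; first exact: df'.
  by apply: differentiable_sum => k; apply: differentiableZ; exact: dg'.
apply: etrans (hessE _ _ _ _ dF) _; rewrite (grad_comb _ _ _ df dg).
(* An entry of the gradient is again a combination of scalar functions, so [derivative_comb] applies
   a second time. *)
have -> : (fun z => (grad f - \sum_k y 0 k *: grad (g k)) z 0 j) =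
    (fun z => grad f z 0 j) - \sum_k y 0 k *: (fun z => grad (g k) z 0 j).
  apply/funext => z; rewrite [LHS]mxE [X in _ + X = _]mxE [in LHS]fct_sumE summxE.
  rewrite fctE fctE fct_sumE; congr (_ - _).
  by apply: eq_bigr => k _; rewrite mxE.
rewrite derivative_comb; last first.
- by move=> k; apply: differentiable_grad_entry; exact: dg'.
- by apply: differentiable_grad_entry; exact: df'.
congr (_ - _); first exact: esym (hessE _ _ _ _ (df' x)).
apply: eq_bigr => k _; congr (_ * _).
exact: esym (hessE _ _ _ _ (dg' k x)).
Qed.

Variables (f : 'rV[R]_n -> R) (h : 'rV[R]_n -> 'rV[R]_m).
Hypothesis f_C2 : twice_continuously_differentiable f.
Hypothesis h_C2 : forall i, twice_continuously_differentiable (fun x => h x 0 i).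

Let hk k x := h x 0 k.

Let df x : differentiable f x. Proof. by case: f_C2. Qed.

Let dgf x : differentiable (grad f) x. Proof. by case: f_C2 => _ + _; exact. Qed.

Let cf : continuous (hess f). Proof. by case: f_C2. Qed.

Let dh k x : differentiable (hk k) x. Proof. by case: (h_C2 k). Qed.

Let dgh k x : differentiable (grad (hk k)) x.
Proof. by case: (h_C2 k) => _ + _; exact. Qed.

Let ch k : continuous (hess (hk k)). Proof. by case: (h_C2 k). Qed.

Lemma lagrE y : lagr f h ^~ y = f - \sum_k y 0 k *: hk k.
Proof. by apply/funext => x; rewrite /lagr !fctE fct_sumE. Qed.

(** This makes the dependence on [y] explicitly affine, so that joint continuity in [(x, y)] follows
    from continuity of the Hessians in [x]. *)
Lemma hessxx_lagrE x y i j : hessxx_lagr f h x y i j =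
  hess f x i j - \sum_k y 0 k * hess (hk k) x i j.
Proof.
rewrite /hessxx_lagr lagrE.
exact: (hess_comb _ _ _ _ _ _ df dh dgf dgh).
Qed.

Lemma JacE x i j : Jac h x i j = grad (hk i) x 0 j.
Proof.
(* Smoothness is assumed componentwise; [h] is recovered as the sum of its components times basis
   vectors. *)
have dhx : differentiable h x.
  have -> : h = \sum_k (fun z => hk k z *: delta_mx 0 k).
    by apply/funext => z; rewrite fct_sumE [LHS]row_sum_delta.
  apply: differentiable_sum => k; apply: differentiableZl.
  exact: dh.
have := deriveEjacobian (delta_mx 0 j) dhx.
rewrite derive_mx; last exact: diff_derivable.
by move=> /(congr1 (fun A : 'rV_m => A 0 i)); rewrite -rowE !mxE.
Qed.

Lemma continuous_lsubmx : continuous (fun z : 'rV[R]_(n + m) => lsubmx z).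
Proof.
move=> z; apply: (cvg_mx (nbhs z)) => i j; rewrite mxE.
under eq_fun do rewrite mxE.
exact: coord_continuous.
Qed.

Lemma continuous_Jac_entry i j : continuous (fun x => Jac h x i j).
Proof.
have -> : (fun x => Jac h x i j) = (fun x => grad (hk i) x 0 j).
  by apply/funext => x; exact: JacE.
move=> x; apply: differentiable_continuous; apply: differentiable_grad_entry.
exact: dgh.
Qed.

Lemma cvg_Jac (z : 'rV[R]_(n + m)) i j :
  Jac h (lsubmx z') i j @[z' --> z] --> Jac h (lsubmx z) i j.
Proof.
exact: (continuous_comp (continuous_lsubmx z)
  (continuous_Jac_entry i j (lsubmx z))).
Qed.

Lemma cvg_hess_entry (g : 'rV[R]_n -> R) (z : 'rV[R]_(n + m)) i j :
  continuous (hess g) ->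
  hess g (lsubmx z') i j @[z' --> z] --> hess g (lsubmx z) i j.
Proof.
move=> hg.
have hij : {for hess g (lsubmx z), continuous (fun A : 'M[R]_n => A i j)}.
  exact: coord_continuous.
apply: (continuous_comp (continuous_lsubmx z)
  (_ : {for lsubmx z, continuous (fun x => hess g x i j)})).
exact: (continuous_comp (hg (lsubmx z)) hij).
Qed.

Lemma cvg_hessxx_lagr (z : 'rV[R]_(n + m)) i j :
  hessxx_lagr f h (lsubmx z') (rsubmx z') i j @[z' --> z] -->
  hessxx_lagr f h (lsubmx z) (rsubmx z) i j.
Proof.
have HE : (fun z' : 'rV[R]_(n + m) => hessxx_lagr f h (lsubmx z') (rsubmx z') i j)
    = (fun z' => hess f (lsubmx z') i j -
        \sum_k rsubmx z' 0 k * hess (hk k) (lsubmx z') i j).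
  by apply/funext => z'; exact: hessxx_lagrE.
rewrite [X in X @ _ --> _]HE.
rewrite [X in _ --> X](hessxx_lagrE (lsubmx z) (rsubmx z) i j).
apply: (cvgB (F := nbhs z)); first exact: (cvg_hess_entry f z i j cf).
apply: (cvg_sum_ord (F := nbhs z)) => k.
apply: (cvgM (F := nbhs z)); last exact: (cvg_hess_entry (hk k) z i j (@ch k)).
by rewrite mxE; under eq_fun do rewrite mxE; exact: coord_continuous.
Qed.

(** * Entries and continuity of the KKT matrix *)

Lemma G_ul x y T k l : G f h x y T (lshift m k) (lshift m l) =
  hessxx_lagr f h x y (enum_val k) (enum_val l).
Proof. by rewrite /G block_mxEul; exact: mxE. Qed.

Lemma G_ur x y T k l : G f h x y T (lshift m k) (rshift #|T| l) =
  - Jac h x l (enum_val k).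
Proof.
rewrite /G block_mxEur; apply: etrans (mxE _ _ _ _) _; congr (- _).
by apply: etrans (mxE _ _ _ _) _; exact: mxE.
Qed.

Lemma G_dl x y T k l : G f h x y T (rshift #|T| k) (lshift m l) =
  - Jac h x k (enum_val l).
Proof.
rewrite /G block_mxEdl; apply: etrans (mxE _ _ _ _) _; congr (- _).
exact: mxE.
Qed.

Lemma G_dr x y T k l : G f h x y T (rshift #|T| k) (rshift #|T| l) = 0.
Proof. by rewrite /G block_mxEdr; exact: mxE. Qed.

Lemma continuous_G T :
  continuous (fun z : 'rV[R]_(n + m) => G f h (lsubmx z) (rsubmx z) T).
Proof.
move=> z; apply: (cvg_mx (nbhs z)) => i j.
case: (split_ordP i) => k ->; case: (split_ordP j) => l ->.
- rewrite [X in _ --> X]G_ul; under eq_fun do rewrite G_ul.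
  exact: cvg_hessxx_lagr.
- rewrite [X in _ --> X]G_ur; under eq_fun do rewrite G_ur.
  by apply: (cvgN (F := nbhs z)); exact: cvg_Jac.
- rewrite [X in _ --> X]G_dl; under eq_fun do rewrite G_dl.
  by apply: (cvgN (F := nbhs z)); exact: cvg_Jac.
- rewrite [X in _ --> X]G_dr; under eq_fun do rewrite G_dr.
  exact: (@cvg_cst _ _ _ (nbhs z) _).
Qed.

End LagrangianDerivatives.

(** Each absolute value moves by at most [e], so a gap larger than [2 * e] keeps its sign. *)
Lemma ltr_norm_perturb {R : realDomainType} (a a' b b' e : R) :
  `|a - a'| <= e -> `|b - b'| <= e -> `|b'| + 2 * e < `|a'| -> `|b| < `|a|.
Proof.
move=> ae be gap; have := lerB_dist a' a; have := lerB_dist b b'.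
by rewrite [`|a' - a|]distrC; lra.
Qed.

(** * Identification of the support near the stationary point *)

Section Identification.
Context {R : realType} {n m s : nat}.
Variables (f : 'rV[R]_n -> R) (h : 'rV[R]_n -> 'rV[R]_m).
Variables (beta delta0 L1 : R) (xs : 'rV[R]_n) (ys : 'rV[R]_m).

(* Each entry of [x - beta *: gradx_lagr] moves by at most
   [(1 + beta * L1) * delta1 / 2], which does not close the gap between the
   entries on and off the support of [xs]. *)
Lemma TT_sub_Js_at x y T :
  0 < beta -> 0 < L1 -> strong_lagr_stationary f h s beta xs ys ->
  (forall (x : 'rV[R]_n) (y : 'rV[R]_m) (x' : 'rV[R]_n) (y' : 'rV[R]_m),
     norm2 (row_mx x y - row_mx xs ys) < delta0 ->
     norm2 (row_mx x' y' - row_mx xs ys) < delta0 ->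
     norm2 (gradx_lagr f h x y - gradx_lagr f h x' y')
       <= L1 * norm2 (row_mx x y - row_mx x' y')) ->
  norm2 (row_mx x y - row_mx xs ys) < delta0 ->
  norm2 (row_mx x y - row_mx xs ys) < delta1 f h beta L1 xs ys / 2 ->
  T \in TT f h s beta x y -> T \in Js_at s xs.
Proof.
move=> beta0 L10 [pxs _] gradL_lip xy0 xy1.
have pxs' : Defs.proj (sparse s) (xs - beta *: gradx_lagr f h xs ys) xs.
  by rewrite pxs.
rewrite inE => /andP[Ts /forall_inP uT].
set u := x - beta *: gradx_lagr f h x y in uT.
set us := xs - beta *: gradx_lagr f h xs ys in pxs pxs'.
set d := norm2 _ in xy0 xy1.
have d0 : 0 <= d := norm2_ge0 _.
have C0 : 0 < 1 + beta * L1 by rewrite addr_gt0// mulr_gt0.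
have close k : `|u 0 k - us 0 k| <= (1 + beta * L1) * d.
  have xk : `|x 0 k - xs 0 k| <= d.
    have <- : (row_mx x y - row_mx xs ys) 0 (lshift m k) = x 0 k - xs 0 k.
      by rewrite opp_row_mx add_row_mx row_mxEl !mxE.
    exact: norm_entry_le_norm2.
  (* The Lipschitz bound is used between [(x, y)] and the center [(xs, ys)] itself. *)
  have zz : norm2 (row_mx xs ys - row_mx xs ys) < delta0.
    by rewrite subrr norm2_0; exact: le_lt_trans d0 xy0.
  have := le_trans (norm_entry_le_norm2 _ 0 k) (gradL_lip _ _ _ _ xy0 zz).
  rewrite -/d; set q := gradx_lagr f h x y in u uT *.
  set qs := gradx_lagr f h xs ys in us pxs pxs' *.
  have -> : (q - qs) 0 k = q 0 k - qs 0 k by rewrite [LHS]mxE [X in _ + X]mxE.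
  have -> : u 0 k - us 0 k = (x 0 k - xs 0 k) - beta * (q 0 k - qs 0 k).
    by rewrite /u /us !mxE; ring.
  move=> qk; rewrite (le_trans (ler_normB _ _))// mulrDl mul1r lerD//.
  by rewrite normrM gtr0_norm// -mulrA ler_wpM2l// ltW.
apply: (top_set_supp (u := u) T) => // [|i j iT jT|i j ix jx].
- by case: pxs'.
- have /forall_inP := uT _ iT; apply; by rewrite inE.
have gap := delta1_le f h beta L1 xs ys beta0 L10 i j ix jx.
have usi := proj_supp i pxs' ix.
(* Off the support [xs] vanishes, so only the gradient term remains in [us]. *)
have usj : `|us 0 j| = beta * `|gradx_lagr f h xs ys 0 j|.
  rewrite !mxE; move: jx; rewrite inE negbK => /eqP ->.
  by rewrite sub0r normrN normrM gtr0_norm.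
(* The radius [delta1 / 2] gives [2 * d < delta1], and the factor [Num.sqrt 2] from [delta1_le] is
   at least 1. *)
have dd : 2 * ((1 + beta * L1) * d) <
    Num.sqrt 2 * (1 + beta * L1) * delta1 f h beta L1 xs ys.
  apply: (@lt_le_trans _ _ ((1 + beta * L1) * delta1 f h beta L1 xs ys)).
    by rewrite mulrCA ltr_pM2l// mulrC -ltr_pdivlMr.
  rewrite -mulrA ler_peMl//.
    by rewrite mulr_ge0 ?ltW//; move: (le_lt_trans d0 xy1); lra.
  by rewrite -[leLHS]sqrtr1 ler_wsqrtr// ler1n.
apply: (ltr_norm_perturb _ _ _ _ _ (close i) (close j)).
by rewrite usi usj; apply: lt_le_trans gap; rewrite ltrD2l.
Qed.

End Identification.

Theorem theorem3p7 (R : realType) (n m s : nat)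
    (f : 'rV[R]_n -> R) (h : 'rV[R]_n -> 'rV[R]_m)
    (beta : R) (xs : 'rV[R]_n) (ys : 'rV[R]_m) (delta0 L1 L2 : R)
    (m_gt0 : (0 < m)%N) (s_bounds : (0 < s < n)%N)
    (f_C2 : twice_continuously_differentiable f)
    (h_C2 : forall i, twice_continuously_differentiable (fun x => h x 0 i))
    (beta_gt0 : 0 < beta)
    (xs_neq0 : xs != 0)
    (xs_stat : strong_lagr_stationary f h s beta xs ys)
    (LICQ : forall T, T \in Js_at s xs -> \rank (subcols T (Jac h xs)) = m)
    (SOSC : forall T, T \in Js_at s xs -> forall d : 'cV[R]_#|T|,
       d != 0 -> subcols T (Jac h xs) *m d = 0 ->
       0 < (d^T *m submxTT T (hessxx_lagr f h xs ys) *m d) 0 0)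
    (hessf_lip : lipschitz_near (hess f) xs)
    (hessh_lip : forall i, lipschitz_near (hess (fun x => h x 0 i)) xs)
    (delta0_gt0 : 0 < delta0) (L1_gt0 : 0 < L1) (L2_gt0 : 0 < L2)
    (gradL_lip : forall (x : 'rV[R]_n) (y : 'rV[R]_m) (x' : 'rV[R]_n) (y' : 'rV[R]_m),
       norm2 (row_mx x y - row_mx xs ys) < delta0 ->
       norm2 (row_mx x' y' - row_mx xs ys) < delta0 ->
       norm2 (gradx_lagr f h x y - gradx_lagr f h x' y')
         <= L1 * norm2 (row_mx x y - row_mx x' y'))
    (hessL_lip : forall (x : 'rV[R]_n) (y : 'rV[R]_m) (x' : 'rV[R]_n) (y' : 'rV[R]_m),
       norm2 (row_mx x y - row_mx xs ys) < delta0 ->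
       norm2 (row_mx x' y' - row_mx xs ys) < delta0 ->
       spnorm (hess_lagr f h x y - hess_lagr f h x' y')
         <= L2 * norm2 (row_mx x y - row_mx x' y')) :
  exists deltat M : R,
    [/\ 0 < deltat <= Num.min delta0 (delta1 f h beta L1 xs ys),
        0 < M &
        forall (x : 'rV[R]_n) (y : 'rV[R]_m),
          nbhd_sparse s xs ys deltat (row_mx x y) ->
          forall T, T \in TT f h s beta x y ->
            G f h x y T \in unitmx /\ spnorm (invmx (G f h x y T)) <= M].
Proof.
case/andP: s_bounds => s_gt0 s_lt_n.
have [pxs _] := xs_stat.
have d1_gt0 : 0 < delta1 f h beta L1 xs ys.
  exact: (delta1_gt0 f h beta L1 xs ys beta_gt0 L1_gt0 s_lt_n xs_neq0 pxs).
(* For each [T] a radius and a bound on the inverse are chosen together; sets outside [Js_at s xs]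
   get the dummy pair [(0, 0)]. *)
have /choice[cM cMP] T : exists cM : R * R, T \in Js_at s xs ->
    [/\ 0 < cM.1, 0 < cM.2 &
     forall x y, norm2 (row_mx x y - row_mx xs ys) < cM.1 ->
       G f h x y T \in unitmx /\ spnorm (invmx (G f h x y T)) <= cM.2].
  have [TJ|_] := boolP (T \in Js_at s xs); last by exists (0, 0).
  have Gu : G f h xs ys T \in unitmx.
    apply: bordered_unitmx => [|d d0 Ad]; first exact: LICQ.
    by rewrite gt_eqF// SOSC.
  have [c [M [c0 M0 GM]]] := unitmx_perturb _ Gu.
  have /cvgrPdist_lt/(_ _ c0)/nbhs_ballP[e /= e0 Ge] :=
    continuous_G f h f_C2 h_C2 T (row_mx xs ys).
  exists (e, M) => _; split; [exact: e0|exact: M0|move=> x y xye; apply: GM].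
  (* Library balls are for the max norm, so the Euclidean ball of the same radius lies inside. *)
  have zb : ball (row_mx xs ys) e (row_mx x y).
    by rewrite -ball_normE/= distrC; exact: le_lt_trans (norm_le_norm2 _) xye.
  by have := Ge _ zb; rewrite !row_mxKl !row_mxKr.
(* The default value 1 keeps [r] and [M] positive whatever the index set. *)
pose r := \big[Num.min/1]_(T in Js_at s xs) (cM T).1.
pose M := \big[Num.max/1]_(T in Js_at s xs) (cM T).2.
have r0 : 0 < r.
  by apply/bigmin_gtP; split=> // T /cMP[].
(* The three radii serve, in order, the Lipschitz bound, the inclusion of [TT] in [Js_at s xs], and
   the bounds on the inverses. *)
exists (Num.min (Num.min delta0 (delta1 f h beta L1 xs ys / 2)) r), M.
split.
- rewrite !lt_min delta0_gt0 r0 divr_gt0//= le_min !ge_min lexx/=.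
  by rewrite ler_pdivrMr// ler_peMr ?ler1n ?orbT// ltW.
- by apply: (@lt_le_trans _ _ 1) => //; exact: bigmax_ge_id.
move=> x y [_]; rewrite !lt_min => /andP[/andP[xy0 xy1] xyr] T TT_T.
have TJ : T \in Js_at s xs.
  exact: TT_sub_Js_at beta_gt0 L1_gt0 xs_stat gradL_lip xy0 xy1 TT_T.
have [_ _ /(_ x y)[]] := cMP _ TJ.
  by apply: lt_le_trans xyr _; exact: bigmin_le_cond.
by move=> Gu GM; split=> //; apply: le_trans GM _; exact: le_bigmax_cond.
Qed.
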